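(* There exist universal constants $C,c>0$ such that the following holds. Let $d,n\in\mathbb{N}$, $R_0\ge1$ and $\Theta_{R_0}:=\{\mathbf u\in\mathbb{R}^d:R_0\le\|\mathbf u\|_2\le2R_0\}$. If $n\ge C\big(R_0+\frac{d}{R_0}\big)$, then any estimator $\tilde{\boldsymbol\theta}=\tilde{\boldsymbol\theta}((\mathbf x_i,y_i)_{i=1}^n)$ (measurable function of the data with values in $\mathbb{R}^d$) satisfies $$\sup_{\boldsymbol\theta^*\in\Theta_{R_0}}\mathbb{E}_{\boldsymbol\theta^*}\|\tilde{\boldsymbol\theta}-\boldsymbol\theta^*\|_2\ \ge\ c\left(\sqrt{\frac{R_0d}{n}}+\sqrt{\frac{R_0^3}{n}}\right).$$
   Context: Logistic regression with Gaussian design: $\mathbb{E}_{\boldsymbol\theta^*}$ denotes expectation when $(\mathbf x_1,y_1),\dots,(\mathbf x_n,y_n)$ are i.i.d. with $\mathbf x_i\sim N(\mathbf 0,\mathbf I_d)$ and $y_i\mid\mathbf x_i\sim\mathrm{Bernoulli}(s(\mathbf x_i^\top\boldsymbol\theta^* ))$, where $s(a)=(1+e^{-a})^{-1}$. ''Universal constant'' means a constant not depending on $n,d,R_0$ or the estimator. *)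

(* Defs.v *)
From HB Require Import structures.
From mathcomp Require Import all_boot all_order all_algebra.
From mathcomp Require Import all_classical all_reals all_analysis.
From mathcomp Require Import measurable_realfun.

Set Implicit Arguments.
Unset Strict Implicit.
Unset Printing Implicit Defensive.

Import Order.TTheory GRing.Theory Num.Theory.
Import numFieldNormedType.Exports.

Local Open Scope classical_set_scope.
Local Open Scope ring_scope.

(* R^d is [d.-tuple R], whose canonical sigma-algebra is the one generated by
   the coordinates, i.e. the Borel sigma-algebra of R^d. *)
Section euclidean.
Context (R : realType) (d : nat).
Implicit Types u v : d.-tuple R.

Definition dot u v : R := \sum_(i < d) tnth u i * tnth v i.

Definition vsub u v : d.-tuple R := [tuple tnth u i - tnth v i | i < d].

Definition norm2 u : R := Num.sqrt (dot u u).

End euclidean.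

Section tuple_cons.
Context dT (T : measurableType dT) (n : nat).

Definition tcons (p : T * n.-tuple T) : n.+1.-tuple T := [tuple of p.1 :: p.2].

Lemma measurable_tcons : measurable_fun [set: T * n.-tuple T] tcons.
Proof. by apply: measurable_cons. Qed.

HB.instance Definition _ :=
  isMeasurableFun.Build _ _ _ _ tcons measurable_tcons.

End tuple_cons.

(* The law P^{(x) n} of n i.i.d. draws from P: the image of P \x P^{(x) n}
   under (x, t) |-> x :: t. *)
Section iid.
Context dT (T : measurableType dT) (R : realType) (P : probability T R).

Fixpoint iid (n : nat) : probability (n.-tuple T) R :=
  if n is m.+1 then distribution (P \x iid m)%E (@tcons _ T m)
  else \d_[tuple].

Lemma iid_rect n (A : 'I_n -> set T) : (forall i, measurable (A i)) ->
  iid n [set t | forall i, A i (tnth t i)] = (\prod_(i < n) P (A i))%E.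
Proof.
elim: n A => [|n IHn] A mA.
  by rewrite big_ord0 /= diracE mem_set// => -[].
rewrite big_ord_recl -IHn; last by move=> i; exact: mA.
rewrite /= /distribution /pushforward.
rewrite (_ : _ @^-1` _ =
    A ord0 `*` [set t : n.-tuple T | forall i, A (lift ord0 i) (tnth t i)]).
  rewrite product_measure1E//.
  rewrite [X in measurable X](_ : _ = \bigcap_(i in [set: 'I_n])
      ((fun t : n.-tuple T => tnth t i) @^-1` A (lift ord0 i))).
    apply: fin_bigcap_measurable => // i _.
    by rewrite -[X in measurable X]setTI; exact: measurable_tnth.
  by apply/seteqP; split=> [t At i _|t At i]; [exact: (At i)|exact: (At i I)].
apply/seteqP; split=> [[x t] /= At|[x t] /= [Ax At] i].
  by split=> [|i]; [have := At ord0|have := At (lift ord0 i); rewrite tnthS].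
by case: (unliftP ord0 i) => [j ->|->]; rewrite ?tnthS.
Qed.

End iid.

(* The joint law P(dx) k(x, dy) of (x, y) when x ~ P and y | x ~ k x. *)
Section joint.
Context d1 d2 (T1 : measurableType d1) (T2 : measurableType d2) (R : realType).
Variables (P : probability T1 R) (k : R.-pker T1 ~> T2).
Local Open Scope ereal_scope.

Definition joint (A : set (T1 * T2)) : \bar R :=
  \int[P]_x k x (xsection A x).

Let joint0 : joint set0 = 0.
Proof. by rewrite /joint integral0_eq// => x _; rewrite xsection0. Qed.

Let joint_ge0 A : 0 <= joint A.
Proof. exact: integral_ge0. Qed.

Let joint_sigma_additive : semi_sigma_additive joint.
Proof.
move=> F mF tF mUF.
rewrite [X in _ --> X](_ : _ = \sum_(n <oo) joint (F n)).
  by apply/cvg_closeP; split; [exact: is_cvg_nneseries|rewrite closeE].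
rewrite -integral_nneseries//; last first.
  by move=> n; apply: measurable_fun_xsection_finite_kernel; rewrite inE.
apply: eq_integral => x _; apply/esym/cvg_lim => //=; rewrite xsection_bigcup.
apply: (measure_sigma_additive _ (trivIset_xsection tF)) => ?.
exact: measurable_xsection.
Qed.

HB.instance Definition _ := isMeasure.Build _ _ _ joint
  joint0 joint_ge0 joint_sigma_additive.

Let joint_setT : joint setT = 1.
Proof.
rewrite /joint; under eq_integral do rewrite xsectionE preimage_setT prob_kernel.
by rewrite integral_cst//= mul1e probability_setT.
Qed.

HB.instance Definition _ := Measure_isProbability.Build _ _ _ joint joint_setT.

End joint.

Section std_normal.
Context (R : realType).

(* [normal_prob] lives on [measurableTypeR R], which has the same carrier and
   the same measurable sets as [R] but another display; pushing it forward
   along the identity moves it to [R]. *)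
Definition idR : measurableTypeR R -> R := idfun.

HB.instance Definition _ :=
  @isMeasurableFun.Build _ _ (measurableTypeR R) R idR
    (@measurable_id _ _ setT).

Definition std_normal : probability R R :=
  distribution (normal_prob (0 : R) 1) idR.

End std_normal.

Section logistic_model.
Context (R : realType) (d : nat).
Implicit Types (x theta : d.-tuple R).

Definition sigmoid (a : R) : R := (1 + expR (- a))^-1.

Lemma measurable_sigmoid_dot theta :
  measurable_fun [set: d.-tuple R] (fun x => sigmoid (dot x theta)).
Proof.
have md : measurable_fun [set: d.-tuple R] (fun x => dot x theta).
  apply: measurable_sum => i.
  by apply: measurable_funM => //; exact: measurable_tnth.
apply: (measurableT_comp _ md); apply: continuous_measurable_fun => a.
rewrite /continuous_at /sigmoid; apply: cvgV.
  by rewrite gt_eqF// ltr_pwDl ?expR_ge0.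
apply: cvgD; first exact: cvg_cst.
apply: (@cvg_comp _ _ _ -%R expR); [|exact: continuous_expR];
  exact: opp_continuous.
Qed.

Definition label_law theta x : pprobability bool R :=
  bernoulli_prob (sigmoid (dot x theta)).

Lemma measurable_label_law theta :
  measurable_fun [set: d.-tuple R] (label_law theta).
Proof.
exact: (measurableT_comp measurable_bernoulli_prob
  (measurable_sigmoid_dot theta)).
Qed.

(* N(0, I_d): its coordinates are i.i.d. N(0, 1). *)
Definition std_gaussian : probability (d.-tuple R) R :=
  iid (std_normal R) d.

Definition logistic_law theta : probability (d.-tuple R * bool)%type R :=
  joint std_gaussian (kprobability (measurable_label_law theta)).

Definition shell (R0 : R) : set (d.-tuple R) :=
  [set u | R0 <= norm2 u <= 2 * R0].

(* Takes values in [0, +oo]: the expectation need not be finite. *)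
Definition risk (n : nat) (est : n.-tuple (d.-tuple R * bool) -> d.-tuple R)
    theta : \bar R :=
  'E_(iid (logistic_law theta) n)[fun D => norm2 (vsub (est D) theta)].

End logistic_model.

(* Main.v *)
(* The risk is bounded below along two kinds of perturbations of a parameter
   supported on the first coordinate. Changing its length from [r] to [r + h]
   gives laws at chi-square distance of order [h ^ 2 / r ^ 3], since a label is
   random only when [|x_1|] is of order [1 / r]; two points with
   [h ^ 2 ~ r ^ 3 / n] give the second term. Changing another coordinate by [h]
   gives chi-square distance of order [h ^ 2 / r], so a hypercube of side
   [h ~ sqrt (r / n)] in the other coordinates (Assouad) gives the first term;
   the L1 loss is bounded by [sqrt d] times the L2 loss. When [d = 1] the second
   term dominates the first.
   Two points are compared through the likelihood ratio [L] and the bound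
   [min 1 L >= L - L ^ 2 / 4], which needs only the second moment of [L] and
   hence tensorises. *)

Require Import Defs.
From HB Require Import structures.
From mathcomp Require Import all_boot all_order all_algebra.
From mathcomp Require Import all_classical all_reals all_analysis.
From mathcomp Require Import measurable_realfun ring lra.
Import Order.TTheory GRing.Theory Num.Theory.
Import numFieldNormedType.Exports.
Local Open Scope classical_set_scope.
Local Open Scope ring_scope.

Set Implicit Arguments.
Unset Strict Implicit.
Unset Printing Implicit Defensive.

(** * Integration against mixtures, joint laws and i.i.d. samples *)

Section mixture.
Context dY dZ (Y : measurableType dY) (Z : measurableType dZ) (R : realType).
Variables (P : {measure set Y -> \bar R}) (mu : {measure set Z -> \bar R}).
Variable k : Y -> {measure set Z -> \bar R}.
Hypothesis mk : forall U, measurable U -> measurable_fun [set: Y] (k ^~ U).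
Hypothesis muE : forall U, measurable U -> mu U = (\int[P]_y k y U)%E.
Local Open Scope ereal_scope.

Import HBNNSimple.

Lemma mixture_integral_nnsfun (f : {nnsfun Z >-> R}) :
  \int[mu]_z (f z)%:E = \int[P]_y \int[k y]_z (f z)%:E.
Proof.
rewrite integralT_nnsfun sintegralE.
under [RHS]eq_integral do rewrite integralT_nnsfun sintegralE.
rewrite ge0_integral_fsum//; last 2 first.
- by move=> r; apply: measurable_funeM; exact: mk.
- by move=> r y _; exact: nnsfun_mulemu_ge0.
apply: eq_fsbigr => r; rewrite inE => -[z _ <-{r}].
by rewrite ge0_integralZl ?lee_fin// -?muE//; exact: mk.
Qed.

(** Simple functions pass to the limit by monotone convergence on both sides. This serves both the
    joint law of covariate and label and the standard normal law. *)
Lemma mixture_integral f : (forall z, 0 <= f z) -> measurable_fun [set: Z] f ->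
  \int[mu]_z f z = \int[P]_y \int[k y]_z f z.
Proof.
move=> f0 mf.
pose f_ := nnsfun_approx measurableT mf.
have limf (m : {measure set Z -> \bar R}) :
    (\int[m]_z (f_ n z)%:E) @[n --> \oo] --> \int[m]_z f z.
  rewrite [X in _ --> X](_ : _ = \int[m]_z (lim ((f_ n z)%:E @[n --> \oo]))).
    apply: cvg_monotone_convergence => //.
    - by move=> n; exact/measurable_EFinP.
    - by move=> n z _; rewrite lee_fin.
    - by move=> z _ a b ab; rewrite lee_fin; exact/lefP/nd_nnsfun_approx.
  by apply: eq_integral => z _; apply/esym/cvg_lim => //; exact: cvg_nnsfun_approx.
have limP : (\int[P]_y \int[k y]_z (f_ n z)%:E) @[n --> \oo] -->
    \int[P]_y \int[k y]_z f z.
  rewrite [X in _ --> X](_ : _ =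
      \int[P]_y (lim ((\int[k y]_z (f_ n z)%:E) @[n --> \oo]))).
    apply: cvg_monotone_convergence => //.
    - move=> n; apply: measurable_fun_integral_kernel => //.
      + by move=> z; rewrite lee_fin.
      + exact/measurable_EFinP.
    - by move=> n y _; apply: integral_ge0 => // z _; rewrite lee_fin.
    - move=> y _ a b ab; apply: ge0_le_integral => //.
      + by move=> z _; rewrite lee_fin.
      + exact/measurable_EFinP.
      + exact/measurable_EFinP.
      + by move=> z _; rewrite lee_fin; exact/lefP/nd_nnsfun_approx.
  by apply: eq_integral => y _; apply/esym/cvg_lim => //; exact: limf.
have fE : (fun n => \int[mu]_z (f_ n z)%:E) =
    (fun n => \int[P]_y \int[k y]_z (f_ n z)%:E).
  by apply/funext => n; rewrite mixture_integral_nnsfun.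
by move: (limf mu); rewrite fE => /cvg_unique; apply.
Qed.

End mixture.

Section joint_integral.
Context d1 d2 (T1 : measurableType d1) (T2 : measurableType d2) (R : realType).
Variables (P : probability T1 R) (k : R.-pker T1 ~> T2).
Local Open Scope ereal_scope.

Let pairx (x : T1) (y : T2) : T1 * T2 := (x, y).

Let measurable_pairx x : measurable_fun [set: T2] (pairx x).
Proof. exact: measurable_pair1. Qed.

HB.instance Definition _ x :=
  isMeasurableFun.Build _ _ _ _ (pairx x) (measurable_pairx x).

(** The joint law is the mixture over [x] of the images of [k x] under [y |-> (x, y)]. *)
Lemma joint_integral f : (forall z, 0 <= f z) ->
  measurable_fun [set: T1 * T2] f ->
  \int[joint P k]_z f z = \int[P]_x \int[k x]_y f (x, y).
Proof.
move=> f0 mf.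
rewrite (@mixture_integral _ _ _ _ _ P _ (fun x => pushforward (k x) (pairx x)))//.
- apply: eq_integral => x _; rewrite ge0_integral_pushforward//.
- move=> U mU; rewrite [X in measurable_fun _ X](_ : _ = fun x => k x (xsection U x)).
    by apply: measurable_fun_xsection_finite_kernel; rewrite inE.
  by apply/funext => x; rewrite xsectionE.
- by move=> U mU; apply: eq_integral => x _; rewrite xsectionE.
Qed.

End joint_integral.

Lemma probability_integral_cst d (T : measurableType d) (R : realType)
  (P : probability T R) (c : \bar R) : (\int[P]_x c = c)%E.
Proof.
transitivity (c * P setT)%E; first exact: integral_cst.
by rewrite probability_setT mule1.
Qed.

Section iid_integral.
Context dT (T : measurableType dT) (R : realType) (P : probability T R).
Local Open Scope ereal_scope.

Lemma iid_integralS n (f : n.+1.-tuple T -> \bar R) : (forall z, 0 <= f z) ->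
  measurable_fun setT f ->
  \int[iid P n.+1]_t f t = \int[P]_x \int[iid P n]_t f (tcons (x, t)).
Proof.
move=> f0 mf; rewrite /= /distribution ge0_integral_pushforward//.
rewrite fubini_tonelli1// => [|z]; last exact: f0.
by apply: measurableT_comp => //; exact: measurable_tcons.
Qed.

(** Tonelli with the head coordinate innermost, the order suited to a bound that is uniform in the
    remaining coordinates. *)
Lemma iid_integralS_swap n (f : n.+1.-tuple T -> \bar R) : (forall z, 0 <= f z) ->
  measurable_fun setT f ->
  \int[iid P n.+1]_t f t = \int[iid P n]_t \int[P]_x f (tcons (x, t)).
Proof.
move=> f0 mf; rewrite iid_integralS//.
have := @fubini_tonelli _ _ T _ R P (iid P n) (f \o @tcons _ T n).
apply=> [|z]; last exact: f0.
by apply: measurableT_comp => //; exact: measurable_tcons.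
Qed.

Lemma iid_integral_tnth n (f : T -> \bar R) (i : 'I_n) : (forall z, 0 <= f z) ->
  measurable_fun setT f ->
  \int[iid P n]_t f (tnth t i) = \int[P]_x f x.
Proof.
move=> f0 mf; elim: n i => [[]//|n IHn] i.
have mfi : measurable_fun setT (fun t : n.+1.-tuple T => f (tnth t i)).
  by apply: measurableT_comp => //; exact: measurable_tnth.
have [j ->|->] := unliftP ord0 i.
  rewrite iid_integralS_swap//; last first.
    by apply: measurableT_comp => //; exact: measurable_tnth.
  rewrite -(IHn j); apply: eq_integral => t _.
  under eq_integral do rewrite tnthS/=.
  exact: probability_integral_cst.
rewrite iid_integralS//; last first.
  by apply: measurableT_comp => //; exact: measurable_tnth.
apply: eq_integral => x _; exact: (probability_integral_cst _ (f x)).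
Qed.

End iid_integral.

(** * The two-point inequality: [l] is the density of [Q] with respect to [P], and [M] bounds its
    second moment *)

Section two_point.
Context dT (T : measurableType dT) (R : realType) (P Q : probability T R).
Variables (l : T -> R) (M : R).
Hypothesis l0 : forall x, 0 <= l x.
Hypothesis ml : measurable_fun setT l.
Hypothesis QlP : forall f : T -> \bar R, (forall x, 0 <= f x)%E ->
  measurable_fun setT f -> (\int[Q]_x f x = \int[P]_x ((l x)%:E * f x))%E.
Hypothesis l2M : (\int[P]_x (l x ^+ 2)%:E <= M%:E)%E.
Local Open Scope ereal_scope.

(* Integrating the bound for [n] with weight [a * l x] over the first
   coordinate [x] gives the bound for [n.+1]; at [n = 0] it reads
   [a - a ^ 2 / 4 <= min 1 a]. *)
Lemma chi2_two_point_weighted n (f g : n.-tuple T -> \bar R) (K a : R) :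
  (0 <= K)%R -> (0 <= a)%R ->
  (forall t, 0 <= f t) -> (forall t, 0 <= g t) ->
  measurable_fun setT f -> measurable_fun setT g ->
  (forall t, K%:E <= f t + g t) ->
  (K * a)%:E <= \int[iid P n]_t f t + a%:E * \int[iid Q n]_t g t
                + (K * a ^+ 2 * M ^+ n / 4)%:E.
Proof.
have M0 : (0 <= M)%R.
  rewrite -lee_fin; apply: le_trans l2M.
  by apply: integral_ge0 => x _; rewrite lee_fin sqr_ge0.
elim: n f g K a => [|n IHn] f g K a K0 a0 f0 g0 mf mg fgK.
  rewrite /= !integral_dirac//= !diracT !mul1e expr0 mulr1.
  move: (f0 [tuple]) (g0 [tuple]) (fgK [tuple]).
  case: (f _) => [u| |]//; case: (g _) => [v| |]//.
  - rewrite -EFinM -!EFinD !lee_fin => u0 v0 Kuv.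
    (* For [a <= 1], [a * (u + v) <= u + a * v]. For [a >= 1], [u + v <= u + a * v], and
       [a - a ^ 2 / 4 <= 1] because [(1 - a / 2) ^ 2 >= 0]. *)
    have [a1|/ltW a1] := leP a 1%R.
      have : (a * K <= a * (u + v))%R by rewrite ler_wpM2l.
      have : (a * u <= u)%R by rewrite ler_piMl.
      have : (0 <= K * a ^+ 2)%R by rewrite mulr_ge0// sqr_ge0.
      lra.
    have : (v <= a * v)%R by rewrite ler_peMl.
    have : (0 <= K * (1 - a / 2) ^+ 2)%R by rewrite mulr_ge0// sqr_ge0.
    lra.
  (* Here [g] is [+oo]. The product [0 * +oo] is [0], so [a = 0] is treated apart; the left side
     then vanishes too. *)
  - move=> u0 _ _; move: a0; rewrite le_eqVlt => /predU1P[<-|a0].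
      by rewrite mulr0 mul0e adde0 -EFinD lee_fin !expr2 !(mul0r, mulr0) addr0.
    by rewrite gt0_muley ?lte_fin// addey// addye// leey.
  - by move=> _ v0 _; rewrite -EFinM !addye// leey.
  - move=> _ _ _; move: a0; rewrite le_eqVlt => /predU1P[<-|a0].
      by rewrite mul0e !addye// leey.
    by rewrite gt0_muley ?lte_fin// !addye// leey.
pose F x := \int[iid P n]_t f (tcons (x, t)).
pose G x := \int[iid Q n]_t g (tcons (x, t)).
have mfc : measurable_fun setT (f \o @tcons _ T n).
  by apply: measurableT_comp => //; exact: measurable_tcons.
have mgc : measurable_fun setT (g \o @tcons _ T n).
  by apply: measurableT_comp => //; exact: measurable_tcons.
have F0 x : 0 <= F x by exact: integral_ge0.
have G0 x : 0 <= G x by exact: integral_ge0.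
have mF : measurable_fun setT F.
  have := @measurable_fun_fubini_tonelli_F _ _ T _ R (iid P n) _ mfc.
  by apply=> z; exact: f0.
have mG : measurable_fun setT G.
  have := @measurable_fun_fubini_tonelli_F _ _ T _ R (iid Q n) _ mgc.
  by apply=> z; exact: g0.
rewrite iid_integralS// iid_integralS// -/F -/G QlP//.
have mlE : measurable_fun setT (fun x => (l x)%:E) by exact/measurable_EFinP.
have ml2 : measurable_fun setT (fun x => (l x ^+ 2)%:E).
  by apply/measurable_EFinP; exact: measurable_funX.
have mlG : measurable_fun setT (fun x => (l x)%:E * G x).
  by apply: emeasurable_funM.
have lG0 x : 0 <= (l x)%:E * G x by rewrite mule_ge0// lee_fin.
pose c := (K * a ^+ 2 * M ^+ n / 4)%R.
have c0 : (0 <= c)%R by rewrite !mulr_ge0// ?sqr_ge0// exprn_ge0.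
have int_l : \int[P]_x (l x)%:E = 1.
  have := QlP (f := cst 1) (fun=> lee01) (measurable_cst _).
  rewrite probability_integral_cst => ->.
  by apply: eq_integral => x _; rewrite mule1.
(* The density [l] integrates to 1, so [K * a] becomes an integral to which the induction hypothesis
   applies pointwise. *)
apply: (@le_trans _ _ (\int[P]_x ((K * a)%:E * (l x)%:E))).
  by rewrite ge0_integralZl// ?int_l ?mule1// ?lee_fin ?mulr_ge0// => x _; rewrite lee_fin.
apply: (@le_trans _ _ (\int[P]_x (F x + a%:E * ((l x)%:E * G x)
    + c%:E * (l x ^+ 2)%:E))).
  apply: ge0_le_integral => //.
  - by move=> x _; rewrite -EFinM lee_fin mulr_ge0// mulr_ge0.
  - exact: measurable_funeM.
  - apply: emeasurable_funD; last exact: measurable_funeM.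
    by apply: emeasurable_funD => //; exact: measurable_funeM.
  - move=> x _.
    have := IHn (fun t => f (tcons (x, t))) (fun t => g (tcons (x, t)))
      K (a * l x)%R K0 (mulr_ge0 a0 (l0 x)) (fun t => f0 _) (fun t => g0 _) _ _
      (fun t => fgK _).
    rewrite -/(F x) -/(G x) -!EFinM mulrA muleA -EFinM.
    rewrite (_ : K * (a * l x) ^+ 2 * M ^+ n / 4 = c * l x ^+ 2)%R; last first.
      by rewrite /c; ring.
    apply.
    + by apply: (measurableT_comp mfc); exact: measurable_pair1.
    + by apply: (measurableT_comp mgc); exact: measurable_pair1.
rewrite ge0_integralD//; last 4 first.
- by move=> x _; rewrite adde_ge0// mule_ge0// lee_fin.
- by apply: emeasurable_funD => //; exact: measurable_funeM.
- by move=> x _; rewrite -EFinM lee_fin mulr_ge0// sqr_ge0.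
- exact: measurable_funeM.
rewrite ge0_integralD//; last 2 first.
- by move=> x _; rewrite mule_ge0// lee_fin.
- exact: measurable_funeM.
rewrite ge0_integralZl// ge0_integralZl//; last 1 first.
- by move=> x _; rewrite lee_fin sqr_ge0.
apply: leeD => //.
rewrite (_ : K * a ^+ 2 * M ^+ n.+1 / 4 = c * M)%R; last by rewrite /c (exprS M); ring.
rewrite [(c * M)%:E]EFinM; apply: lee_wpmul2l => //; rewrite lee_fin.
Qed.

(** The weighted bound at [a = 1] loses [K * M ^ n / 4], which is at most half of [K]. *)
Lemma chi2_two_point n (f g : n.-tuple T -> \bar R) (K : R) :
  (0 <= K)%R -> (M ^+ n <= 2)%R ->
  (forall t, 0 <= f t) -> (forall t, 0 <= g t) ->
  measurable_fun setT f -> measurable_fun setT g ->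
  (forall t, K%:E <= f t + g t) ->
  (K / 2)%:E <= \int[iid P n]_t f t + \int[iid Q n]_t g t.
Proof.
move=> K0 Mn f0 g0 mf mg fgK.
have := chi2_two_point_weighted K0 ler01 f0 g0 mf mg fgK.
rewrite mulr1 mul1e expr1n mulr1 -leeBlDr// -EFinB; apply: le_trans.
rewrite lee_fin.
have : (K * M ^+ n <= K * 2)%R by rewrite ler_wpM2l.
lra.
Qed.

End two_point.

(** * The logistic function and its derivative *)

Section sigmoid_facts.
Context (R : realType).
Implicit Types a b t x : R.

(** This is both the derivative of [sigmoid] and the variance of a Bernoulli label with parameter
    [sigmoid a]. *)
Definition dsigmoid a : R := sigmoid a * (1 - sigmoid a).

Lemma sigmoid_gt0 a : 0 < sigmoid a.
Proof. by rewrite invr_gt0 addr_gt0// expR_gt0. Qed.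

Lemma onem_sigmoid a : 1 - sigmoid a = sigmoid (- a).
Proof.
rewrite /sigmoid opprK expRN.
have e0 := expR_gt0 a; have := e0; rewrite lt0r => /andP[en0 _].
field; rewrite en0 /= !gt_eqF ?addr_gt0//.
Qed.

Lemma sigmoid_lt1 a : sigmoid a < 1.
Proof. by rewrite -subr_gt0 onem_sigmoid sigmoid_gt0. Qed.

Lemma dsigmoid_gt0 a : 0 < dsigmoid a.
Proof. by rewrite mulr_gt0 ?sigmoid_gt0// onem_sigmoid sigmoid_gt0. Qed.

Lemma dsigmoidN a : dsigmoid (- a) = dsigmoid a.
Proof. by rewrite /dsigmoid !onem_sigmoid opprK mulrC. Qed.

(** Evenness reduces to [a >= 0]. The form in [expR (- |a|)] yields the two-sided comparison with
    exponential decay. *)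
Lemma dsigmoidE a : dsigmoid a = expR (- `|a|) / (1 + expR (- `|a|)) ^+ 2.
Proof.
wlog a0 : a / 0 <= a.
  move=> H; have [|/ltW a0] := leP 0 a; first exact: H.
  by rewrite -dsigmoidN -normrN H// oppr_ge0.
rewrite ger0_norm// /dsigmoid /sigmoid.
have e0 := expR_gt0 (- a).
by field; rewrite gt_eqF// addr_gt0.
Qed.

Lemma dsigmoid_le_expR a : dsigmoid a <= expR (- `|a|).
Proof.
rewrite dsigmoidE ler_piMr ?expR_ge0// invf_le1 ?exprn_gt0 ?addr_gt0 ?expR_gt0//.
by rewrite exprn_ege1// lerDl expR_ge0.
Qed.

Lemma expR_le_dsigmoid a : expR (- `|a|) <= 4 * dsigmoid a.
Proof.
rewrite dsigmoidE mulrCA ler_peMr ?expR_ge0//.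
rewrite ler_pdivlMr ?exprn_gt0 ?addr_gt0 ?expR_gt0// mul1r.
have : expR (- `|a|) <= 1 by rewrite -expR0 ler_expR oppr_le0.
have := expR_gt0 (- `|a|); nra.
Qed.

(** Multiplicative form of the fact that the logarithm of [sigmoid] has derivative [1 - sigmoid],
    which lies between 0 and 1. *)
Lemma sigmoid_lip a b : sigmoid b <= sigmoid a * expR `|b - a|.
Proof.
rewrite /sigmoid mulrC ler_pdivlMr ?addr_gt0 ?expR_gt0// mulrC.
rewrite ler_pdivrMr ?addr_gt0 ?expR_gt0// mulrDr mulr1 -expRD lerD//.
  by rewrite -expR0 ler_expR.
by rewrite ler_expR; have := ler_norm (b - a); lra.
Qed.

Lemma onemexpRN_le a : `|1 - expR (- a)| <= `|a| * expR `|a|.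
Proof.
have ea := expR_ge1Dx a; have eNa := expR_ge1Dx (- a).
have [a0|a0] := leP 0 a.
  rewrite ger0_norm; last by rewrite subr_ge0 -expR0 ler_expR oppr_le0.
  by rewrite ger0_norm//; nra.
rewrite ler0_norm; last by rewrite subr_le0 -expR0 ler_expR oppr_ge0 ltW.
rewrite ltr0_norm// opprB.
have : (1 + a) * expR (- a) <= expR a * expR (- a) by rewrite ler_wpM2r ?expR_ge0.
rewrite -expRD subrr expR0; lra.
Qed.

(** The factor [dsigmoid a] records that a nearly deterministic label is insensitive to the
    parameter. It comes from an exact factorization in which [sigmoid b] is traded for [sigmoid a]
    at the cost of one exponential. *)
Lemma sigmoid_diff_le a b :
  `|sigmoid b - sigmoid a| <= `|b - a| * expR (2 * `|b - a|) * dsigmoid a.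
Proof.
have -> : sigmoid b - sigmoid a
    = sigmoid b * (1 - sigmoid a) * (1 - expR (- (b - a))).
  rewrite onem_sigmoid /sigmoid opprK opprB expRD !expRN.
  have ea := expR_gt0 a; have eb := expR_gt0 b.
  by field; rewrite !gt_eqF ?addr_gt0.
rewrite !normrM (gtr0_norm (sigmoid_gt0 b)).
rewrite onem_sigmoid (gtr0_norm (sigmoid_gt0 _)).
rewrite (_ : _ * dsigmoid a = (sigmoid a * expR `|b - a|) * sigmoid (- a)
    * (`|b - a| * expR `|b - a|)); last first.
  rewrite mulr_natl mulr2n expRD /dsigmoid onem_sigmoid; ring.
apply: ler_pM => //; last exact: onemexpRN_le.
  by rewrite mulr_ge0// ltW// sigmoid_gt0.
by rewrite ler_wpM2r ?sigmoid_lip// ltW// sigmoid_gt0.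
Qed.

(** The left side equals [1 + (sigmoid b - sigmoid a) ^ 2 / dsigmoid a], one plus a chi-square
    divergence. Squaring [sigmoid_diff_le] gives [dsigmoid a ^ 2], and one factor cancels. *)
Lemma bernoulli_chi2_le a b :
  sigmoid b ^+ 2 / sigmoid a + (1 - sigmoid b) ^+ 2 / (1 - sigmoid a)
  <= 1 + (b - a) ^+ 2 * expR (4 * `|b - a|) * dsigmoid a.
Proof.
have d0 := dsigmoid_gt0 a.
have -> : sigmoid b ^+ 2 / sigmoid a + (1 - sigmoid b) ^+ 2 / (1 - sigmoid a)
    = 1 + `|sigmoid b - sigmoid a| ^+ 2 / dsigmoid a.
  have p0 := sigmoid_gt0 a.
  have p1 : 0 < 1 - sigmoid a by rewrite subr_gt0 sigmoid_lt1.
  rewrite real_normK ?num_real// /dsigmoid.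
  by field; rewrite !gt_eqF.
rewrite lerD2l ler_pdivrMr//.
apply: (@le_trans _ _ ((`|b - a| * expR (2 * `|b - a|) * dsigmoid a) ^+ 2)).
  rewrite lerXn2r ?sigmoid_diff_le// nnegrE//.
  by rewrite mulr_ge0 ?(ltW d0)// mulr_ge0// expR_ge0.
rewrite !exprMn real_normK ?num_real// -expRM_natl.
rewrite (_ : 2 * (2 * _) = 4 * `|b - a|) //; last by ring.
by rewrite -[leRHS]mulrA -expr2 /dsigmoid exprMn.
Qed.

Lemma continuous_sigmoid : continuous (@sigmoid R).
Proof.
move=> a; rewrite /continuous_at /sigmoid; apply: cvgV.
  by rewrite gt_eqF// ltr_pwDl ?expR_ge0.
apply: cvgD; first exact: cvg_cst.
apply: (@cvg_comp _ _ _ -%R expR); [|exact: continuous_expR];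
  exact: opp_continuous.
Qed.

Lemma continuous_dsigmoid : continuous dsigmoid.
Proof.
move=> a; apply: cvgM; first exact: continuous_sigmoid.
by apply: cvgB; [exact: cvg_cst|exact: continuous_sigmoid].
Qed.

Lemma is_derive_sigmoid a : is_derive a 1 (@sigmoid R) (dsigmoid a).
Proof.
have e0 := expR_gt0 (- a).
have n0 : 1 + expR (- a) != 0 by rewrite gt_eqF// addr_gt0.
have H : is_derive a 1 (fun x : R => 1 + expR (- x)) (- expR (- a)).
  by apply: is_derive_eq; rewrite add0r mul1r mulrN1.
have := @is_deriveV _ (fun x => 1 + expR (- x)) a _ 1 n0 H.
rewrite /dsigmoid (_ : _ *: _ = sigmoid a * (1 - sigmoid a))//.
by rewrite /sigmoid /GRing.scale/=; field.
Qed.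

(** A primitive is [k^-1 * sigmoid (k * x + m)], with limit [k^-1] at infinity and a positive value
    at 0. *)
Lemma integral_dsigmoid_pinfty (k m : R) : 0 < k ->
  (\int[lebesgue_measure]_(x in `[0%R, +oo[) (dsigmoid (k * x + m))%:E
   <= (k^-1)%:E)%E.
Proof.
move=> k0.
have dF x : is_derive x 1 (fun x => k^-1 * sigmoid (k * x + m))
    (dsigmoid (k * x + m)).
  have D : is_derive x 1 (fun x => k * x + m) k.
    by apply: is_derive_eq; rewrite addr0 /GRing.scale/= mulr1.
  have := @is_derive1_comp _ _ (fun x => k * x + m) x _ _ (is_derive_sigmoid (k * x + m)) D.
  move=> /(is_deriveZ k^-1); rewrite /GRing.scale/=.
  by rewrite mulrCA mulVf ?gt_eqF// mulr1.
have cF : continuous (fun x => k^-1 * sigmoid (k * x + m)).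
  by move=> x; apply/differentiable_continuous/derivable1_diffP.
have cf : continuous (fun x => dsigmoid (k * x + m)).
  move=> x; apply: (@cvg_comp _ _ _ (fun x => k * x + m) dsigmoid).
    by apply: cvgD; [apply: cvgMr; exact: cvg_id|exact: cvg_cst].
  exact: continuous_dsigmoid.
rewrite (@ge0_continuous_FTC2y _ _ (fun x => k^-1 * sigmoid (k * x + m)) _ k^-1)//.
- rewrite -EFinB lee_fin gerBl.
  by rewrite mulr_ge0// ltW// ?invr_gt0// sigmoid_gt0.
- by move=> x _; rewrite ltW// dsigmoid_gt0.
- exact: continuous_subspaceT.
- rewrite -[X in _ --> X]mulr1; apply: cvgMr.
  rewrite -[X in _ --> X]invr1; apply: cvgV; first exact: oner_neq0.
  rewrite -[X in _ --> X]addr0; apply: cvgD; first exact: cvg_cst.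
  apply: (@cvg_comp _ _ _ (fun x => k * x + m) (fun x => expR (- x))).
    apply/cvgryPge => A; exists ((A - m) / k); split; first exact: num_real.
    by move=> x; rewrite ltr_pdivrMr// => /ltW; rewrite lerBlDr mulrC.
  exact: cvgr_expR.
- by apply: cvg_at_right_filter; exact: cF.
- by move=> x _; rewrite derive1E derive_val.
Qed.

Lemma integral_dsigmoid (k m : R) : 0 < k ->
  (\int[lebesgue_measure]_x (dsigmoid (k * x + m))%:E <= (2 / k)%:E)%E.
Proof.
move=> k0.
have cf m' : continuous (fun x => dsigmoid (k * x + m')).
  move=> x; apply: (@cvg_comp _ _ _ (fun x => k * x + m') dsigmoid).
    by apply: cvgD; [apply: cvgMr; exact: cvg_id|exact: cvg_cst].
  exact: continuous_dsigmoid.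
have mf : measurable_fun [set: R] (fun x => dsigmoid (k * x + m)).
  exact: continuous_measurable_fun.
rewrite -(setUv `[0%R, +oo[%classic) ge0_integral_setU//=; last 4 first.
  exact: measurableC.
  by apply/measurable_EFinP; rewrite setUv.
  by move=> x _; rewrite lee_fin ltW// dsigmoid_gt0.
  exact/disj_setPCl.
rewrite setCitvr integral_itv_bndo_bndc; last first.
  exact/measurable_EFinP/measurable_funTS.
(* Reflection and evenness of [dsigmoid] turn the negative half-line into the positive one with
   [- m] for [m]. Each half contributes at most [k^-1]. *)
rewrite -{2}oppr0 ge0_integration_by_substitutionNy//; last 2 first.
  exact: continuous_subspaceT.
  by move=> x _; rewrite ltW// dsigmoid_gt0.
rewrite (_ : 2 / k = k^-1 + k^-1)%R; last by ring.
rewrite EFinD; apply: leeD; first exact: integral_dsigmoid_pinfty.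
under eq_integral.
  move=> x _ /=; rewrite -dsigmoidN opprD mulrN opprK.
  over.
exact: integral_dsigmoid_pinfty.
Qed.

End sigmoid_facts.

(** * One-dimensional Gaussian integrals *)

Section gaussian_integrals.
Context (R : realType).
Local Notation mu := (@lebesgue_measure R).

(** Presents N(0, 1) as a Lebesgue mixture of point masses weighted by the density, so that
    [mixture_integral] applies. *)
Let pdf_dirac (x : R) : {measure set R -> \bar R} :=
  mscale (NngNum (normal_pdf_ge0 0 1 x)) (dirac x).

Lemma std_normal_integral (f : R -> \bar R) : (forall x, (0 <= f x)%E) ->
  measurable_fun setT f ->
  (\int[std_normal R]_x f x = \int[mu]_x ((normal_pdf 0 1 x)%:E * f x))%E.
Proof.
move=> f0 mf.
rewrite (@mixture_integral _ _ _ _ _ mu (std_normal R) pdf_dirac)//.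
- apply: eq_integral => x _; rewrite ge0_integral_mscale//= integral_dirac//=.
  by rewrite diracT mul1e.
- move=> U mU; apply: emeasurable_funM.
    by apply/measurable_EFinP; exact: measurable_normal_pdf.
  by apply/measurable_EFinP; exact: measurable_indic.
- move=> U mU; rewrite /std_normal /distribution /pushforward /normal_prob/=.
  rewrite [LHS]integral_mkcond; apply: eq_integral => x _.
  rewrite patchE /mscale/= diracE.
  by case: ifPn => _; rewrite ?mule1 ?mule0.
Qed.

Lemma normal_pdf01_le x : normal_pdf 0 1 x <= expR (- (x ^+ 2 / 2)) :> R.
Proof.
rewrite normal_pdfE ?oner_neq0// /normal_fun subr0 expr1n mulNr.
rewrite ler_piMl ?expR_ge0// /normal_peak expr1n mul1r.
have pi2 : 0 < pi + pi :> R by rewrite addr_gt0 ?pi_gt0.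
rewrite invf_le1 mulr2n ?sqrtr_gt0//.
rewrite -[leLHS]sqrtr1 ler_wsqrtr//.
have := @pihalf_ge1 R; lra.
Qed.

Lemma normal_pdf01_le1 x : normal_pdf 0 1 x <= 1 :> R.
Proof.
apply: le_trans (normal_pdf01_le x) _.
by rewrite -expR0 ler_expR oppr_le0 divr_ge0// sqr_ge0.
Qed.

Lemma sqr_le_expR (u : R) : 0 <= u -> u ^+ 2 <= 2 * expR u.
Proof. by move=> u0; have := expR_ge1Dxn 1 u0; rewrite (_ : 2`! = 2)%N//; lra. Qed.

Lemma measurable_dsigmoid : measurable_fun [set: R] (@dsigmoid R).
Proof. by apply: continuous_measurable_fun; exact: continuous_dsigmoid. Qed.

(** The normal density is at most 1, so the Lebesgue bound carries over, uniformly in the shift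
    [m]. *)
Lemma std_normal_dsigmoid (k m : R) : 0 < k ->
  (\int[std_normal R]_x (dsigmoid (x * k + m))%:E <= (2 / k)%:E)%E.
Proof.
move=> k0.
have mf : measurable_fun [set: R] (fun x => dsigmoid (x * k + m)).
  apply: (measurableT_comp measurable_dsigmoid).
  by apply: measurable_funD => //; exact: measurable_funM.
rewrite std_normal_integral//; last 2 first.
- by move=> x; rewrite lee_fin ltW// dsigmoid_gt0.
- exact/measurable_EFinP.
apply: le_trans (integral_dsigmoid m k0); apply: ge0_le_integral => //.
- by move=> x _; rewrite -EFinM lee_fin mulr_ge0 ?normal_pdf_ge0// ltW// dsigmoid_gt0.
- apply: emeasurable_funM; apply/measurable_EFinP => //.
  exact: measurable_normal_pdf.
- apply/measurable_EFinP; under eq_fun do rewrite mulrC; exact: mf.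
- move=> x _; rewrite -EFinM lee_fin mulrC [x * k]mulrC.
  by rewrite ler_piMr ?normal_pdf01_le1// ltW// dsigmoid_gt0.
Qed.

(* The factor comes from [3 * |x| - x ^ 2 / 2 <= 9 / 2]. *)
Definition gauss_const : R := 16 * expR (9 / 2).

(** The condition on [h] gives [4 * |x * h| <= |x|], and [x ^ 2 <= 2 * expR |x|]. The Gaussian
    factor absorbs both exponentials and leaves [expR (- |x|)], which is integrated through
    [dsigmoid]. *)
Lemma std_normal_sqr_expR (h : R) : `|h| <= 1 / 4 ->
  (\int[std_normal R]_x ((x * h) ^+ 2 * expR (4 * `|x * h|))%:E
    <= (gauss_const * h ^+ 2)%:E)%E.
Proof.
move=> h4.
have mf : measurable_fun [set: R] (fun x => (x * h) ^+ 2 * expR (4 * `|x * h|)).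
  have mxh : measurable_fun [set: R] (fun x => x * h) by exact: measurable_funM.
  apply: measurable_funM; first exact: measurable_funX.
  apply: measurableT_comp => //; apply: measurable_funM => //.
  exact: measurableT_comp.
rewrite std_normal_integral//; last 2 first.
- by move=> x; rewrite lee_fin mulr_ge0 ?sqr_ge0 ?expR_ge0.
- exact/measurable_EFinP.
(* The 8 is 2 from [sqr_le_expR] times 4 from [expR_le_dsigmoid]; the integral of [dsigmoid] brings
   another 2. *)
pose c := 8 * expR (9 / 2) * h ^+ 2.
have c0 : 0 <= c by rewrite mulr_ge0 ?sqr_ge0// mulr_ge0 ?expR_ge0.
apply: (@le_trans _ _ (\int[mu]_x (c%:E * (dsigmoid (1 * x + 0))%:E))%E).
  apply: ge0_le_integral => //.
  - by move=> x _; rewrite -EFinM lee_fin mulr_ge0 ?normal_pdf_ge0// mulr_ge0 ?sqr_ge0 ?expR_ge0.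
  - apply: emeasurable_funM; apply/measurable_EFinP => //.
    exact: measurable_normal_pdf.
  - apply: measurable_funeM; apply/measurable_EFinP.
    under eq_fun do rewrite mul1r addr0; exact: measurable_dsigmoid.
  - move=> x _; rewrite -!EFinM lee_fin mul1r addr0.
    apply: (@le_trans _ _ (expR (- (x ^+ 2 / 2)) * (h ^+ 2 * (2 * expR `|x|) * expR `|x|))).
      apply: ler_pM; rewrite ?normal_pdf_ge0 ?normal_pdf01_le//.
        by rewrite mulr_ge0 ?sqr_ge0 ?expR_ge0.
      apply: ler_pM; rewrite ?sqr_ge0 ?expR_ge0//.
        rewrite exprMn mulrC ler_wpM2l ?sqr_ge0//.
        by rewrite -[leLHS]real_normK ?num_real// sqr_le_expR.
      rewrite ler_expR normrM mulrCA ler_piMr//; lra.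
    rewrite (_ : _ * _ = 2 * h ^+ 2 * expR (- (x ^+ 2 / 2) + `|x| + `|x|)); last first.
      by rewrite !expRD; ring.
    apply: (@le_trans _ _ (2 * h ^+ 2 * (expR (9 / 2) * expR (- `|x|)))).
      rewrite ler_wpM2l ?(mulr_ge0 _ (sqr_ge0 h))// -expRD ler_expR.
      rewrite -[x ^+ 2]real_normK ?num_real//.
      have := sqr_ge0 (`|x| - 3); lra.
    have := expR_le_dsigmoid x.
    move=> /(ler_wpM2l (mulr_ge0 (expR_ge0 (9 / 2)) (sqr_ge0 h))).
    rewrite /c; lra.
rewrite ge0_integralZl//; last 2 first.
- apply/measurable_EFinP.
  under eq_fun do rewrite mul1r addr0; exact: measurable_dsigmoid.
- by move=> x _; rewrite lee_fin ltW// dsigmoid_gt0.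
apply: (@le_trans _ _ (c%:E * (2 / 1)%:E)%E).
  by apply: lee_wpmul2l => //; exact: integral_dsigmoid.
by rewrite -EFinM lee_fin /c /gauss_const; lra.
Qed.

(** The decay comes from [dsigmoid (x * r)], the normal density being bounded by 1. Only [|x|] of
    order [1 / r] matters: [x ^ 2] contributes [r ^ -2] and the width of the window [r ^ -1]. *)
Lemma std_normal_sqr_dsigmoid (r h : R) : 0 < r -> `|h| <= r / 8 ->
  (\int[std_normal R]_x
      ((x * h) ^+ 2 * expR (4 * `|x * h|) * dsigmoid (x * r))%:E
    <= (1024 * h ^+ 2 / r ^+ 3)%:E)%E.
Proof.
move=> r0 hr.
have mf : measurable_fun [set: R]
    (fun x => (x * h) ^+ 2 * expR (4 * `|x * h|) * dsigmoid (x * r)).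
  have mxh : measurable_fun [set: R] (fun x => x * h) by exact: measurable_funM.
  apply: measurable_funM.
    apply: measurable_funM; first exact: measurable_funX.
    apply: measurableT_comp => //; apply: measurable_funM => //.
    exact: measurableT_comp.
  by apply: (measurableT_comp measurable_dsigmoid); exact: measurable_funM.
have f0 x : 0 <= (x * h) ^+ 2 * expR (4 * `|x * h|) * dsigmoid (x * r).
  by rewrite mulr_ge0 ?(ltW (dsigmoid_gt0 _))// mulr_ge0 ?sqr_ge0 ?expR_ge0.
rewrite std_normal_integral//; last first.
  exact/measurable_EFinP.
(* With [u = r * |x| / 4], half of the decay of [dsigmoid] absorbs the
   exponential factor and a quarter of it absorbs [u ^ 2 <= 2 * expR u]. *)
pose c := 128 * h ^+ 2 / r ^+ 2.
have c0 : 0 <= c by rewrite divr_ge0 ?sqr_ge0// mulr_ge0 ?sqr_ge0.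
have r4 : 0 < r / 4 by rewrite divr_gt0.
apply: (@le_trans _ _ (\int[mu]_x (c%:E * (dsigmoid (r / 4 * x + 0))%:E))%E).
  apply: ge0_le_integral => //.
  - by move=> x _; rewrite -EFinM lee_fin mulr_ge0 ?normal_pdf_ge0.
  - apply: emeasurable_funM; apply/measurable_EFinP => //.
    exact: measurable_normal_pdf.
  - apply: measurable_funeM; apply/measurable_EFinP.
    apply: (measurableT_comp measurable_dsigmoid).
    by apply: measurable_funD => //; exact: measurable_funM.
  - move=> x _; rewrite -!EFinM lee_fin addr0.
    apply: (@le_trans _ _ ((x * h) ^+ 2 * expR (4 * `|x * h|) * dsigmoid (x * r))).
      by rewrite ler_piMl ?normal_pdf01_le1.
    pose u := r / 4 * `|x|.
    have u0 : 0 <= u by rewrite mulr_ge0// ltW.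
    have xE : x ^+ 2 = 16 / r ^+ 2 * u ^+ 2.
      rewrite /u exprMn real_normK ?num_real//.
      by field; rewrite gt_eqF.
    apply: (@le_trans _ _ (h ^+ 2 * (16 / r ^+ 2 * (2 * expR u))
        * expR (u + u) * expR (- (u + u + u + u)))).
      apply: ler_pM.
      + by rewrite mulr_ge0 ?sqr_ge0 ?expR_ge0.
      + by rewrite ltW// dsigmoid_gt0.
      + apply: ler_pM; rewrite ?sqr_ge0 ?expR_ge0//.
          rewrite exprMn mulrC ler_wpM2l ?sqr_ge0// xE.
          by rewrite ler_wpM2l ?sqr_le_expR// divr_ge0 ?sqr_ge0.
        rewrite ler_expR normrM /u.
        have := ler_wpM2l (normr_ge0 x) hr; lra.
      + apply: le_trans (dsigmoid_le_expR _) _.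
        by rewrite ler_expR normrM (gtr0_norm r0) /u; lra.
    rewrite (_ : _ * expR (- _) = 32 * h ^+ 2 / r ^+ 2 * expR (- u)); last first.
      rewrite (_ : - (u + u + u + u) = - u + - u + - u + - u); last by ring.
      rewrite !expRD !expRN; have := expR_gt0 u => eu.
      by field; rewrite !gt_eqF.
    have -> : expR (- u) = expR (- `|r / 4 * x|).
      by rewrite normrM (gtr0_norm r4).
    have := expR_le_dsigmoid (r / 4 * x).
    have rh : 0 <= 32 * h ^+ 2 / r ^+ 2 by rewrite divr_ge0 ?sqr_ge0// mulr_ge0 ?sqr_ge0.
    move=> /(ler_wpM2l rh) /le_trans; apply.
    by rewrite /c le_eqVlt; apply/orP; left; apply/eqP; ring.
rewrite ge0_integralZl//; last 2 first.
- apply/measurable_EFinP/(measurableT_comp measurable_dsigmoid).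
  by apply: measurable_funD => //; exact: measurable_funM.
- by move=> x _; rewrite lee_fin ltW// dsigmoid_gt0.
(* The 128 in [c] is 16 from [x ^ 2 = 16 * u ^ 2 / r ^ 2], times 2 from [sqr_le_expR], times 4 from
   [expR_le_dsigmoid]. The integral adds [8 / r], whence 1024. *)
apply: (@le_trans _ _ (c%:E * (2 / (r / 4))%:E)%E).
  by apply: lee_wpmul2l => //; exact: integral_dsigmoid.
rewrite -EFinM lee_fin /c le_eqVlt; apply/orP; left; apply/eqP.
by field; rewrite gt_eqF.
Qed.

End gaussian_integrals.

(** * Chi-square divergence between two logistic models *)

Section logistic_chi2.
Context (R : realType) (d : nat).
Implicit Types (x theta eta : d.-tuple R).

Lemma measurable_dot theta : measurable_fun [set: d.-tuple R] (fun x => dot x theta).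
Proof.
apply: measurable_sum => i.
by apply: measurable_funM => //; exact: measurable_tnth.
Qed.

Lemma logistic_integral theta (f : d.-tuple R * bool -> \bar R) :
  (forall z, 0 <= f z)%E -> measurable_fun setT f ->
  (\int[logistic_law theta]_z f z =
   \int[std_gaussian R d]_x ((sigmoid (dot x theta))%:E * f (x, true)
     + (1 - sigmoid (dot x theta))%:E * f (x, false)))%E.
Proof.
move=> f0 mf; rewrite joint_integral//; apply: eq_integral => x _.
rewrite /= integral_bernoulli_prob//.
by rewrite !ltW ?sigmoid_gt0 ?sigmoid_lt1.
Qed.

(** Density of the law at [eta] with respect to the law at [theta] for one observation. The
    covariates have the same law under both, so only the label probabilities appear. *)
Definition likelihood_ratio theta eta (z : d.-tuple R * bool) : R :=
  if z.2 then sigmoid (dot z.1 eta) / sigmoid (dot z.1 theta)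
  else (1 - sigmoid (dot z.1 eta)) / (1 - sigmoid (dot z.1 theta)).

Let onem_sigmoid_gt0 (a : R) : 0 < 1 - sigmoid a.
Proof. by rewrite subr_gt0 sigmoid_lt1. Qed.

Lemma likelihood_ratio_ge0 theta eta z : 0 <= likelihood_ratio theta eta z.
Proof.
rewrite /likelihood_ratio; case: ifP => _.
  by rewrite divr_ge0// ltW// sigmoid_gt0.
by rewrite divr_ge0// ltW.
Qed.

Lemma measurable_likelihood_ratio theta eta :
  measurable_fun setT (likelihood_ratio theta eta).
Proof.
have md t : measurable_fun [set: d.-tuple R * bool] (fun z => dot z.1 t).
  by apply: (measurableT_comp (measurable_dot t)); exact: measurable_fst.
have ms t : measurable_fun [set: d.-tuple R * bool]
    (fun z => sigmoid (dot z.1 t)).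
  by apply: (measurableT_comp (measurable_sigmoid_dot t)); exact: measurable_fst.
apply: measurable_fun_ifT; first exact: measurable_snd.
- apply: measurable_funM => //; under eq_fun do rewrite invrK.
  apply: measurable_funD => //; apply: measurableT_comp => //.
  exact: measurableT_comp.
- apply: measurable_funM; first exact: measurable_funB.
  under eq_fun do rewrite onem_sigmoid invrK opprK.
  by apply: measurable_funD => //; exact: measurableT_comp.
Qed.

Lemma logistic_change_of_measure theta eta (f : d.-tuple R * bool -> \bar R) :
  (forall z, 0 <= f z)%E -> measurable_fun setT f ->
  (\int[logistic_law eta]_z f z =
   \int[logistic_law theta]_z ((likelihood_ratio theta eta z)%:E * f z))%E.
Proof.
move=> f0 mf; rewrite [LHS]logistic_integral// [RHS]logistic_integral//; last 2 first.
- by move=> z; rewrite mule_ge0// lee_fin likelihood_ratio_ge0.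
- apply: emeasurable_funM => //; apply/measurable_EFinP.
  exact: measurable_likelihood_ratio.
apply: eq_integral => x _; rewrite /likelihood_ratio/= !muleA -!EFinM.
by rewrite ![_ * (_ / _)]mulrC !divfK// gt_eqF// sigmoid_gt0.
Qed.

(** The bound of [bernoulli_chi2_le] on the chi-square divergence between the two label laws given
    [x]. *)
Definition chi2_density theta eta x : R :=
  (dot x eta - dot x theta) ^+ 2 * expR (4 * `|dot x eta - dot x theta|)
    * dsigmoid (dot x theta).

Lemma chi2_density_ge0 theta eta x : 0 <= chi2_density theta eta x.
Proof.
by rewrite mulr_ge0 ?(ltW (dsigmoid_gt0 _))// mulr_ge0 ?sqr_ge0 ?expR_ge0.
Qed.

Lemma measurable_chi2_density theta eta :
  measurable_fun setT (chi2_density theta eta).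
Proof.
have mdiff : measurable_fun setT (fun x => dot x eta - dot x theta).
  by apply: measurable_funB; exact: measurable_dot.
apply: measurable_funM; last first.
  by apply: (measurableT_comp (@measurable_dsigmoid R)); exact: measurable_dot.
apply: measurable_funM; first exact: measurable_funX.
apply: measurableT_comp => //; apply: measurable_funM => //.
exact: measurableT_comp.
Qed.

(** Given [x], the second moment of the ratio is exactly the left side of [bernoulli_chi2_le]; it
    remains to integrate over [x]. *)
Lemma likelihood_ratio_sqr_le theta eta :
  (\int[logistic_law theta]_z (likelihood_ratio theta eta z ^+ 2)%:E
   <= 1 + \int[std_gaussian R d]_x (chi2_density theta eta x)%:E)%E.
Proof.
rewrite logistic_integral//; last 2 first.
- by move=> z; rewrite lee_fin sqr_ge0.
- by apply/measurable_EFinP/measurable_funX; exact: measurable_likelihood_ratio.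
have mE : measurable_fun setT (fun x => (chi2_density theta eta x)%:E).
  by apply/measurable_EFinP; exact: measurable_chi2_density.
rewrite -[X in (_ <= X + _)%E](probability_integral_cst (std_gaussian R d)).
rewrite -ge0_integralD//; last first.
  by move=> x _; rewrite lee_fin chi2_density_ge0.
apply: ge0_le_integral => //.
- move=> x _; rewrite -!EFinM -EFinD lee_fin addr_ge0//.
    by rewrite mulr_ge0 ?sqr_ge0// ltW// sigmoid_gt0.
  by rewrite mulr_ge0 ?sqr_ge0// ltW.
- have mlr b : measurable_fun [set: d.-tuple R]
      (fun x => (likelihood_ratio theta eta (x, b) ^+ 2)%:E).
    apply/measurable_EFinP/measurable_funX.
    apply: (measurableT_comp (measurable_likelihood_ratio theta eta)).
    exact: measurable_pair2.
  have ms := measurable_sigmoid_dot theta.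
  apply: emeasurable_funD; apply: emeasurable_funM => //; apply/measurable_EFinP => //.
  exact: measurable_funB.
- exact: emeasurable_funD.
- move=> x _; rewrite -!EFinM -!EFinD lee_fin /likelihood_ratio/=.
  apply: le_trans (bernoulli_chi2_le (dot x theta) (dot x eta)).
  have p0 := sigmoid_gt0 (dot x theta); have p1 := onem_sigmoid_gt0 (dot x theta).
  rewrite le_eqVlt; apply/orP; left; apply/eqP.
  by field; rewrite !gt_eqF.
Qed.

End logistic_chi2.

(** * One-coordinate perturbations and the resulting two-point bound *)

Section perturbation.
Context (R : realType).

Lemma dot_tcons m (x0 : R) (x : m.-tuple R) (theta : m.+1.-tuple R) :
  dot (tcons (x0, x)) theta =
  x0 * tnth theta ord0 + \sum_(i < m) tnth x i * tnth theta (lift ord0 i).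
Proof.
by rewrite /dot big_ord_recl; congr +%R; apply: eq_bigr => i _; rewrite tnthS.
Qed.

Definition perturbation d (theta eta : d.-tuple R) (k : 'I_d) (h : R) :=
  forall i, tnth eta i = tnth theta i + (if i == k then h else 0).

Lemma dot_perturbation d (theta eta x : d.-tuple R) k h :
  perturbation theta eta k h -> dot x eta - dot x theta = tnth x k * h.
Proof.
move=> peta; rewrite /dot -sumrB (bigD1 k)//= big1 ?addr0 => [|i ik].
  by rewrite peta eqxx; ring.
by rewrite peta (negbTE ik) addr0 subrr.
Qed.

(* Conditionally on the other coordinates, the first one has density at most
   1, while [dsigmoid (r * x + w)] has integral at most [2 / r] whatever [w]. *)
Lemma chi2_orthogonal m (theta eta : m.+1.-tuple R) (j : 'I_m) (r h : R) :
  0 < r -> tnth theta ord0 = r -> perturbation theta eta (lift ord0 j) h ->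
  `|h| <= 1 / 4 ->
  (\int[std_gaussian R m.+1]_x (chi2_density theta eta x)%:E
   <= (2 * gauss_const R * h ^+ 2 / r)%:E)%E.
Proof.
move=> r0 thr peta h4; pose g (z : R) := (z * h) ^+ 2 * expR (4 * `|z * h|).
have g0 z : 0 <= g z by rewrite mulr_ge0 ?sqr_ge0 ?expR_ge0.
have mxh : measurable_fun [set: R] (fun x => x * h) by exact: measurable_funM.
have mg : measurable_fun [set: R] g.
  apply: measurable_funM; first exact: measurable_funX.
  apply: measurableT_comp => //; apply: measurable_funM => //.
  exact: measurableT_comp.
rewrite /std_gaussian iid_integralS_swap//; last 2 first.
- by move=> x; rewrite lee_fin chi2_density_ge0.
- by apply/measurable_EFinP; exact: measurable_chi2_density.
have mgj : measurable_fun setT (fun x : m.-tuple R => (g (tnth x j))%:E).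
  apply/measurable_EFinP; apply: (measurableT_comp mg); exact: measurable_tnth.
apply: (@le_trans _ _ (\int[iid (std_normal R) m]_x
    ((2 / r)%:E * (g (tnth x j))%:E))%E).
  apply: ge0_le_integral => //.
  - move=> x _; apply: integral_ge0 => y _.
    by rewrite lee_fin chi2_density_ge0.
  - have mc : measurable_fun setT
        ((EFin \o chi2_density theta eta) \o @tcons _ R m).
      apply: measurableT_comp; last exact: measurable_tcons.
      by apply/measurable_EFinP; exact: measurable_chi2_density.
    have := @measurable_fun_fubini_tonelli_G _ _ R _ R (std_normal R) _ mc.
    by apply=> z; rewrite lee_fin chi2_density_ge0.
  - exact: measurable_funeM.
  - move=> x _; pose w := \sum_(i < m) tnth x i * tnth theta (lift ord0 i).
    under eq_integral => y _.
      rewrite /chi2_density (dot_perturbation _ peta) dot_tcons thr tnthS.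
      rewrite -/(g (tnth x j)) -/w EFinM.
      over.
    have mds : measurable_fun [set: R] (fun y => (dsigmoid (y * r + w))%:E).
      apply/measurable_EFinP; apply: (measurableT_comp (@measurable_dsigmoid R)).
      by apply: measurable_funD => //; exact: measurable_funM.
    rewrite ge0_integralZl//; last 2 first.
    - by move=> y _; rewrite lee_fin ltW// dsigmoid_gt0.
    - by rewrite lee_fin.
    rewrite muleC; apply: lee_wpmul2r; first by rewrite lee_fin.
    exact: std_normal_dsigmoid.
rewrite ge0_integralZl//; last 2 first.
- by move=> x _; rewrite lee_fin.
- by rewrite lee_fin divr_ge0// ltW.
have -> : (\int[iid (std_normal R) m]_x (g (tnth x j))%:E
    = \int[std_normal R]_x (g x)%:E)%E.
  apply: (@iid_integral_tnth _ _ _ _ _ (EFin \o g)) => [z|].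
    by rewrite lee_fin.
  exact/measurable_EFinP.
apply: (@le_trans _ _ ((2 / r)%:E * (gauss_const R * h ^+ 2)%:E)%E).
  apply: lee_wpmul2l; first by rewrite lee_fin divr_ge0// ltW.
  exact: std_normal_sqr_expR.
by rewrite -EFinM lee_fin le_eqVlt; apply/orP; left; apply/eqP; ring.
Qed.

(** Both parameters lie on the first axis, so the integrand depends on [x] through its first
    coordinate only and the integral is one-dimensional. *)
Lemma chi2_radial m (theta eta : m.+1.-tuple R) (r h : R) :
  0 < r -> (forall i, tnth theta i = if i == ord0 then r else 0) ->
  perturbation theta eta ord0 h -> `|h| <= r / 8 ->
  (\int[std_gaussian R m.+1]_x (chi2_density theta eta x)%:E
   <= (1024 * h ^+ 2 / r ^+ 3)%:E)%E.
Proof.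
move=> r0 thr peta hr.
have dE x : dot x theta = tnth x ord0 * r.
  rewrite /dot (bigD1 ord0)//= thr eqxx big1 ?addr0// => i i0.
  by rewrite thr (negbTE i0) mulr0.
pose g (z : R) := (z * h) ^+ 2 * expR (4 * `|z * h|) * dsigmoid (z * r).
have mxh : measurable_fun [set: R] (fun x => x * h) by exact: measurable_funM.
have mg : measurable_fun [set: R] g.
  apply: measurable_funM.
    apply: measurable_funM; first exact: measurable_funX.
    apply: measurableT_comp => //; apply: measurable_funM => //.
    exact: measurableT_comp.
  by apply: (measurableT_comp (@measurable_dsigmoid R)); exact: measurable_funM.
under eq_integral => x _.
  rewrite /chi2_density (dot_perturbation _ peta) dE -/(g (tnth x ord0)).
  over.
rewrite /std_gaussian.
have -> : (\int[iid (std_normal R) m.+1]_x (g (tnth x ord0))%:E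
    = \int[std_normal R]_x (g x)%:E)%E.
  apply: (@iid_integral_tnth _ _ _ _ _ (EFin \o g)) => [z|].
    rewrite lee_fin mulr_ge0 ?(ltW (dsigmoid_gt0 _))//.
    by rewrite mulr_ge0 ?sqr_ge0 ?expR_ge0.
  exact/measurable_EFinP.
exact: std_normal_sqr_dsigmoid.
Qed.

(** Converts a chi-square budget [B] per observation into the condition [M ^ n <= 2] for
    [M = 1 + B], through [(1 + B) ^ n <= expR (n * B)]. *)
Lemma exprn_1D_le2 n (B : R) : 0 <= B -> n%:R * B <= 1 / 2 -> (1 + B) ^+ n <= 2.
Proof.
move=> B0 nB; apply: (@le_trans _ _ (expR (n%:R * B))).
  rewrite expRM_natl lerXn2r ?nnegrE ?expR_ge0 ?addr_ge0//.
  exact: expR_ge1Dx.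
apply: (@le_trans _ _ (expR (1 / 2))); first by rewrite ler_expR.
(* [expR (1 / 2) <= 2] follows from [expR (- (1 / 2)) >= 1 / 2]. *)
have := expR_ge1Dx (- (1 / 2) : R); rewrite expRN => h.
have e0 := expR_gt0 (1 / 2 : R).
have : expR (1 / 2 : R) * (1 + - (1 / 2)) <= expR (1 / 2) * (expR (1 / 2))^-1.
  by rewrite ler_wpM2l// ltW.
rewrite divff ?gt_eqF//; lra.
Qed.

Lemma measurable_abs_coord_diff d n
    (est : {mfun n.-tuple (d.-tuple R * bool)%type >-> d.-tuple R}) k (t : R) :
  measurable_fun setT (fun D => (`|tnth (est D) k - t|)%:E).
Proof.
apply/measurable_EFinP; apply: measurableT_comp => //.
apply: measurable_funB => //.
apply: (@measurableT_comp _ _ _ _ _ _ (fun u : d.-tuple R => tnth u k)) => //.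
exact: measurable_tnth.
Qed.

(** No estimate of coordinate [k] is close to both values: by the triangle inequality its two errors
    sum to at least [|h|], which serves as [K] in [chi2_two_point]. *)
Lemma two_point_coordinate d n
    (est : {mfun n.-tuple (d.-tuple R * bool)%type >-> d.-tuple R})
    (theta eta : d.-tuple R) k (h B : R) :
  perturbation theta eta k h -> 0 <= B -> n%:R * B <= 1 / 2 ->
  (\int[std_gaussian R d]_x (chi2_density theta eta x)%:E <= B%:E)%E ->
  ((`|h| / 2)%:E <=
    \int[iid (logistic_law theta) n]_D (`|tnth (est D) k - tnth theta k|)%:E
    + \int[iid (logistic_law eta) n]_D (`|tnth (est D) k - tnth eta k|)%:E)%E.
Proof.
move=> peta B0 nB chiB.
apply: (@chi2_two_point _ _ _ (logistic_law theta) (logistic_law eta)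
  (likelihood_ratio theta eta) (1 + B)).
- exact: likelihood_ratio_ge0.
- exact: measurable_likelihood_ratio.
- exact: logistic_change_of_measure.
- by apply: le_trans (likelihood_ratio_sqr_le _ _) _; rewrite EFinD leeD2l.
- exact: normr_ge0.
- exact: exprn_1D_le2.
- by move=> D; rewrite lee_fin.
- by move=> D; rewrite lee_fin.
- exact: measurable_abs_coord_diff.
- exact: measurable_abs_coord_diff.
- move=> D; rewrite -EFinD lee_fin peta eqxx -normrN.
  rewrite (_ : - h = (tnth (est D) k - (tnth theta k + h))
    - (tnth (est D) k - tnth theta k)); last by ring.
  by apply: le_trans (ler_normB _ _) _; rewrite addrC.
Qed.

End perturbation.

(** * Averaging over the hypercube (Assouad) *)

Section assouad.
Context (R : realType).

Definition flip m (j : 'I_m) (v : {ffun 'I_m -> bool}) : {ffun 'I_m -> bool} :=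
  [ffun i => if i == j then ~~ v i else v i].

Lemma flipK m (j : 'I_m) : involutive (flip j).
Proof.
by move=> v; apply/ffunP => i; rewrite !ffunE; case: eqP => // _; rewrite negbK.
Qed.

(** [flip j] permutes the vertices, so summing the pairwise bound over all of them counts each
    [f j v] twice. Exchanging the sums then compares the average over vertices with [s]. *)
Lemma assouad_sum m (f : 'I_m -> {ffun 'I_m -> bool} -> R) (t s : R) :
  (forall j v, t <= f j v + f j (flip j v)) ->
  (forall v, \sum_j f j v <= s) -> m%:R * t / 2 <= s.
Proof.
move=> ft fs; pose N : R := #|{ffun 'I_m -> bool}|%:R.
have N0 : 0 < N by rewrite ltr0n card_ffun card_bool card_ord expn_gt0.
have le_t j : N * t / 2 <= \sum_v f j v.
  have : \sum_(v : {ffun 'I_m -> bool}) t <= \sum_v (f j v + f j (flip j v)).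
    by apply: ler_sum => v _; exact: ft.
  rewrite sumr_const -mulr_natl -/N big_split/=.
  have <- : \sum_v f j v = \sum_v f j (flip j v).
    by rewrite (reindex_inj (inv_inj (flipK j))).
  lra.
have : \sum_(v : {ffun 'I_m -> bool}) \sum_j f j v <= N * s.
  by rewrite mulr_natl -sumr_const; apply: ler_sum => v _; exact: fs.
rewrite exchange_big/= => /(le_trans (ler_sum _ (fun j _ => le_t j))).
rewrite sumr_const card_ord -[_ *+ m]mulr_natl.
rewrite -[N * t / 2]mulrA mulrCA [m%:R * (t / 2)]mulrA.
by rewrite ler_pM2l.
Qed.

End assouad.

(** * Coordinates against the Euclidean norm *)

Section euclidean_norm.
Context (R : realType) (d : nat).
Implicit Types u v : d.-tuple R.

Lemma dot_ge0 u : 0 <= dot u u.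
Proof. by apply: sumr_ge0 => i _; rewrite -expr2 sqr_ge0. Qed.

Lemma sqr_norm2 u : norm2 u ^+ 2 = dot u u.
Proof. by rewrite sqr_sqrtr// dot_ge0. Qed.

Lemma norm2_ge0 u : 0 <= norm2 u.
Proof. exact: sqrtr_ge0. Qed.

Lemma abs_coord_le_norm2 u k : `|tnth u k| <= norm2 u.
Proof.
rewrite -sqrtr_sqr ler_wsqrtr// /dot (bigD1 k)//= -expr2 lerDl.
by apply: sumr_ge0 => i _; rewrite -expr2 sqr_ge0.
Qed.

End euclidean_norm.

Lemma sum_abs_coord_le_norm2 (R : realType) m (u : m.+1.-tuple R) :
  (0 < m)%N ->
  \sum_j `|tnth u (lift ord0 j)| <= Num.sqrt m%:R * norm2 u.
Proof.
move=> m0; set s := Num.sqrt _; set N := norm2 u.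
have s2 : s ^+ 2 = m%:R by rewrite sqr_sqrtr.
have s0 : 0 < s by rewrite sqrtr_gt0 ltr0n.
(* The argument ends by cancelling [s * N], so a zero norm, which forces zero coordinates, is
   handled first. *)
have := norm2_ge0 u; rewrite le_eqVlt => /predU1P[N0|N0].
  rewrite big1 ?mulr_ge0 ?norm2_ge0 ?(ltW s0)// => j _.
  by apply/eqP; rewrite -normr_le0 normr_id N0; exact: abs_coord_le_norm2.
(* AM-GM: [2 * s * N * |a| <= s ^ 2 * a ^ 2 + N ^ 2] *)
have sumN : \sum_j tnth u (lift ord0 j) ^+ 2 <= N ^+ 2.
  rewrite sqr_norm2 /dot big_ord_recl -expr2.
  under [in leRHS]eq_bigr do rewrite -expr2.
  by rewrite lerDr sqr_ge0.
have : \sum_j (2 * (s * N) * `|tnth u (lift ord0 j)|)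
    <= \sum_j (s ^+ 2 * tnth u (lift ord0 j) ^+ 2 + N ^+ 2).
  apply: ler_sum => j _; rewrite -[tnth _ _ ^+ 2]real_normK ?num_real//.
  have := sqr_ge0 (s * `|tnth u (lift ord0 j)| - N); lra.
rewrite -mulr_sumr big_split/= -mulr_sumr sumr_const card_ord -[_ *+ m]mulr_natl -s2.
move=> /le_trans/(_ (lerD (ler_wpM2l (sqr_ge0 s) sumN) (lexx _))).
rewrite (_ : _ + _ = 2 * (s * N) * (s * N)); last by ring.
by rewrite ler_pM2l// !mulr_gt0.
Qed.

(** * Risk lower bounds along the two kinds of perturbations *)

Section lower_bounds.
Context (R : realType).
Local Notation estimator d n :=
  {mfun n.-tuple (d.-tuple R * bool)%type >-> d.-tuple R}.

Lemma measurable_norm2 d : measurable_fun setT (@norm2 R d).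
Proof.
apply: (@measurableT_comp _ _ _ _ _ _ (@Num.sqrt R) _ (fun u => dot u u)).
  by apply: continuous_measurable_fun; exact: sqrt_continuous.
apply: measurable_sum => i.
by apply: measurable_funM; exact: measurable_tnth.
Qed.

Lemma measurable_loss d n (est : estimator d n) (theta : d.-tuple R) :
  measurable_fun setT (fun D => (norm2 (vsub (est D) theta))%:E).
Proof.
apply/measurable_EFinP; apply: (measurableT_comp (@measurable_norm2 d)).
apply/measurable_fun_tnthP => i.
rewrite (_ : _ \o _ = fun D => tnth (est D) i - tnth theta i); last first.
  by apply/funext => D; rewrite /= tnth_mktuple.
apply: measurable_funB => //.
apply: (@measurableT_comp _ _ _ _ _ _ (fun u : d.-tuple R => tnth u i)) => //.
exact: measurable_tnth.
Qed.

Lemma riskE d n (est : estimator d n) (theta : d.-tuple R) :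
  risk est theta =
  (\int[iid (logistic_law theta) n]_D (norm2 (vsub (est D) theta))%:E)%E.
Proof. by rewrite /risk unlock. Qed.

Lemma coord_risk_le d n (est : estimator d n) (theta : d.-tuple R) k :
  (\int[iid (logistic_law theta) n]_D (`|tnth (est D) k - tnth theta k|)%:E
   <= risk est theta)%E.
Proof.
rewrite riskE; apply: ge0_le_integral => //.
- exact: measurable_abs_coord_diff.
- exact: measurable_loss.
- move=> D _; rewrite lee_fin.
  by have := abs_coord_le_norm2 (vsub (est D) theta) k; rewrite tnth_mktuple.
Qed.

Lemma sum_coord_risk_le m n (est : estimator m.+1 n) (theta : m.+1.-tuple R) :
  (0 < m)%N ->
  (\sum_j \int[iid (logistic_law theta) n]_D
      (`|tnth (est D) (lift ord0 j) - tnth theta (lift ord0 j)|)%:E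
   <= (Num.sqrt m%:R)%:E * risk est theta)%E.
Proof.
move=> m0; rewrite riskE -ge0_integralZl//; last 2 first.
- exact: measurable_loss.
- by move=> D _; rewrite lee_fin norm2_ge0.
rewrite -ge0_integral_sum//; last first.
  by move=> j; exact: measurable_abs_coord_diff.
apply: ge0_le_integral => //.
- by move=> D _; apply: sume_ge0.
- by apply: emeasurable_sum => j; exact: measurable_abs_coord_diff.
- by apply: measurable_funeM; exact: measurable_loss.
- move=> D _; rewrite sumEFin -EFinM lee_fin.
  apply: le_trans (sum_abs_coord_le_norm2 (vsub (est D) theta) m0).
  by apply: ler_sum => j _; rewrite tnth_mktuple.
Qed.

Lemma gauss_const_ge16 : 16 <= gauss_const R.
Proof.
by rewrite /gauss_const; have := expR_ge1Dx (9 / 2 : R); lra.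
Qed.

Lemma radial_lower_bound m n (r s : R) (est : estimator m.+1 n) :
  1 <= r -> r <= n%:R ->
  (forall theta, shell r theta -> (risk est theta <= s%:E)%E) ->
  Num.sqrt (r ^+ 3 / n%:R) / 256 <= s.
Proof.
move=> r1 rn risk_s.
have r0 : 0 < r by rewrite (lt_le_trans ltr01).
have n0 : 0 < n%:R :> R by rewrite (lt_le_trans r0).
set q := Num.sqrt _.
have q2 : q ^+ 2 = r ^+ 3 / n%:R.
  by rewrite sqr_sqrtr// divr_ge0 ?exprn_ge0 ?ltW.
have q0 : 0 <= q by exact: sqrtr_ge0.
(* [r <= n] gives [q <= r], which keeps the step [q / 64] below [r / 8] and the moved point in the
   shell. *)
have qr : q <= r.
  rewrite -ler_sqr ?nnegrE ?(ltW r0)// q2 ler_pdivrMr// exprSr.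
  by rewrite ler_wpM2l ?sqr_ge0.
pose th (x : R) : m.+1.-tuple R := [tuple if i == ord0 then x else 0 | i < m.+1].
have thE x i : tnth (th x) i = if i == ord0 then x else 0 by rewrite tnth_mktuple.
have norm_th x : 0 <= x -> norm2 (th x) = x.
  move=> x0; rewrite /norm2 /dot (bigD1 ord0)//= big1 ?addr0 => [|i i0].
    by rewrite !thE eqxx -expr2 sqrtr_sqr ger0_norm.
  by rewrite !thE (negbTE i0) mulr0.
(* The factor 64 makes [n] times the bound of [chi2_radial] equal to [1 / 4]. *)
have pert : perturbation (th r) (th (r + q / 64)) ord0 (q / 64).
  by move=> i; rewrite !thE; case: ifP => _; rewrite ?addr0.
have h8 : `|q / 64| <= r / 8 by rewrite ger0_norm ?divr_ge0//; lra.
have B0 : 0 <= 1024 * (q / 64) ^+ 2 / r ^+ 3.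
  apply: divr_ge0; last by apply: exprn_ge0; exact: ltW.
  by apply: mulr_ge0; [exact: ler0n|exact: sqr_ge0].
have nB : n%:R * (1024 * (q / 64) ^+ 2 / r ^+ 3) <= 1 / 2.
  have -> : n%:R * (1024 * (q / 64) ^+ 2 / r ^+ 3) = 1 / 4.
    by rewrite expr_div_n q2; field; rewrite !gt_eqF.
  by rewrite !div1r lef_pV2 ?posrE// ler_nat.
have := two_point_coordinate est pert B0 nB (chi2_radial r0 (thE r) pert h8).
have sh0 : shell r (th r) by rewrite /shell/= norm_th ?(ltW r0)//; lra.
have sh1 : shell r (th (r + q / 64)).
  by rewrite /shell/= norm_th; [lra|rewrite addr_ge0 ?divr_ge0 ?(ltW r0)].
(* Both risks are at most [s], so [(q / 64) / 2 <= 2 * s]. *)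
move=> /le_trans/(_ (leeD (coord_risk_le _ _ _) (coord_risk_le _ _ _))).
move=> /le_trans/(_ (leeD (risk_s _ sh0) (risk_s _ sh1))).
rewrite -EFinD lee_fin ger0_norm ?divr_ge0//; lra.
Qed.

Lemma orthogonal_lower_bound m n (r s : R) (est : estimator m.+1 n) :
  (0 < m)%N -> 1 <= r -> 4 * (r + m.+1%:R / r) <= n%:R ->
  (forall theta, shell r theta -> (risk est theta <= s%:E)%E) ->
  Num.sqrt (r * m.+1%:R / n%:R) / (16 * gauss_const R) <= s.
Proof.
move=> m0 r1 rn risk_s; set K := gauss_const R.
have K16 : 16 <= K := gauss_const_ge16.
have K0 : 0 < K by lra.
have r0 : 0 < r by rewrite (lt_le_trans ltr01).
have dr0 : 0 <= m.+1%:R / r by rewrite divr_ge0// ltW.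
have n0 : 0 < n%:R :> R by lra.
pose q := Num.sqrt (r / n%:R).
have q2 : q ^+ 2 = r / n%:R by rewrite sqr_sqrtr// divr_ge0 ?ltW.
have q0 : 0 <= q by exact: sqrtr_ge0.
have q1 : q <= 1.
  by rewrite -ler_sqr ?nnegrE// q2 expr1n ler_pdivrMr// mul1r; lra.
(* Flipping a sign moves a coordinate by [2 * t]. With this [t], [n] times the bound of
   [chi2_orthogonal] is [1 / (2 * K)], and [q <= 1] keeps [2 * t] below the threshold [1 / 4]. *)
have [t tE] : exists t, t = q / (4 * K) by exists (q / (4 * K)).
have t0 : 0 <= t by rewrite tE divr_ge0 ?mulr_ge0 ?(ltW K0).
have t64 : t <= 1 / 64.
  by rewrite tE ler_pdivrMr ?mulr_gt0//; lra.
pose th (v : {ffun 'I_m -> bool}) : m.+1.-tuple R :=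
  [tuple if unlift ord0 i is Some j then (if v j then t else - t) else r
    | i < m.+1].
have th0 v : tnth (th v) ord0 = r by rewrite tnth_mktuple unlift_none.
have thS v j : tnth (th v) (lift ord0 j) = if v j then t else - t.
  by rewrite tnth_mktuple liftK.
have pert v j : perturbation (th v) (th (flip j v)) (lift ord0 j)
    (if v j then - (2 * t) else 2 * t).
  move=> i; have [k ->|->] := unliftP ord0 i; last by rewrite !th0 addr0.
  rewrite !thS (inj_eq lift_inj) ffunE; case: eqP => [->|_]; last by rewrite addr0.
  by case: (v j) => /=; ring.
have sh v : shell r (th v).
  rewrite /shell/=.
  have dE : dot (th v) (th v) = r ^+ 2 + m%:R * t ^+ 2.
    rewrite /dot big_ord_recl th0 -expr2; congr +%R.
    under eq_bigr => j _.
      rewrite thS (_ : _ * _ = t ^+ 2); last by case: ifP => _; ring.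
      over.
    by rewrite sumr_const card_ord mulr_natl.
  have mt0 : 0 <= m%:R * t ^+ 2 by rewrite mulr_ge0 ?sqr_ge0.
  (* The sample size condition on [d / R0] enters here: [m * t ^ 2 <= m * q ^ 2 = m * r / n], and
     [n >= m / r]. The squared norm of each vertex is thus at most [2 * r ^ 2]. *)
  have mt : m%:R * t ^+ 2 <= r ^+ 2.
    have tq : t <= q by rewrite tE ler_pdivrMr ?mulr_gt0// ler_peMr//; lra.
    apply: (@le_trans _ _ (m%:R * q ^+ 2)).
      by rewrite ler_wpM2l// ler_sqr ?nnegrE.
    rewrite q2 mulrA ler_pdivrMr// expr2 -mulrA [r * n%:R]mulrC mulrA mulrC.
    rewrite -mulrA ler_wpM2l ?(ltW r0)//.
    have : m.+1%:R / r <= n%:R by lra.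
    by rewrite ler_pdivrMr// -[m.+1]addn1 natrD; lra.
  have N0 := norm2_ge0 (th v).
  have N2 := sqr_norm2 (th v); rewrite dE in N2.
  apply/andP; split.
    by rewrite -ler_sqr ?nnegrE ?(ltW r0)// N2; lra.
  rewrite -ler_sqr ?nnegrE ?mulr_ge0 ?(ltW r0)// N2 exprMn.
  have := sqr_ge0 r; lra.
pose F j v := (\int[iid (logistic_law (th v)) n]_D
  (`|tnth (est D) (lift ord0 j) - tnth (th v) (lift ord0 j)|)%:E)%E.
have F0 j v : (0 <= F j v)%E by apply: integral_ge0 => D _; rewrite lee_fin.
(* Coordinate risks are finite because the risk is at most [s], so the averaging can take place in
   the reals. *)
have Ffin j v : (F j v)%E \is a fin_num.
  rewrite ge0_fin_numE// (le_lt_trans (coord_risk_le _ _ _))//.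
  by rewrite (le_lt_trans (risk_s _ (sh v)))// ltry.
have Fflip j v : (t%:E <= F j v + F j (flip j v))%E.
  have B0 : 0 <= 2 * K * (2 * t) ^+ 2 / r.
    by rewrite divr_ge0 ?(ltW r0)// mulr_ge0 ?sqr_ge0// mulr_ge0 ?(ltW K0).
  have nB : n%:R * (2 * K * (2 * t) ^+ 2 / r) <= 1 / 2.
    rewrite exprMn tE expr_div_n q2.
    rewrite (_ : _ * _ = 1 / (2 * K)); last by field; rewrite !gt_eqF.
    by rewrite ler_pdivrMr ?mulr_gt0//; lra.
  have habs : `|if v j then - (2 * t) else 2 * t| = 2 * t.
    have t20 : 0 <= 2 * t by exact: mulr_ge0.
    by case: ifP => _; rewrite ?normrN ger0_norm.
  have h4 : `|if v j then - (2 * t) else 2 * t| <= 1 / 4 by rewrite habs; lra.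
  have := chi2_orthogonal r0 (th0 v) (pert v j) h4.
  rewrite (_ : (if v j then _ else _) ^+ 2 = (2 * t) ^+ 2); last first.
    by case: ifP => _; rewrite ?sqrrN.
  move=> /(two_point_coordinate est (pert v j) B0 nB).
  by rewrite habs (_ : 2 * t / 2 = t)//; lra.
have Fsum v : (\sum_j F j v <= (Num.sqrt m%:R * s)%:E)%E.
  apply: le_trans (sum_coord_risk_le est (th v) m0) _.
  rewrite EFinM; apply: lee_wpmul2l; first by rewrite lee_fin sqrtr_ge0.
  exact: risk_s.
clearbody F.
have := @assouad_sum R m (fun j v => fine (F j v)) t (Num.sqrt m%:R * s).
have step1 j v : t <= fine (F j v) + fine (F j (flip j v)).
  by rewrite -lee_fin EFinD (fineK (Ffin _ _)) (fineK (Ffin _ _)).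
have step2 v : \sum_j fine (F j v) <= Num.sqrt m%:R * s.
  rewrite -lee_fin -sumEFin; under eq_bigr do rewrite (fineK (Ffin _ _)).
  exact: Fsum.
move=> /(_ step1 step2).
set w := Num.sqrt m%:R.
have w2 : w ^+ 2 = m%:R by rewrite sqr_sqrtr.
have w0 : 0 < w by rewrite sqrtr_gt0 ltr0n.
rewrite -w2 (_ : _ / 2 = w * (w * t / 2)); last by ring.
rewrite ler_pM2l// => /(le_trans _); apply.
(* Averaging gave [w * t / 2 <= s], with [m] perturbed coordinates instead of the dimension [m.+1];
   since [m >= 1], [m.+1 <= 4 * m]. *)
have : Num.sqrt (r * m.+1%:R / n%:R) <= 2 * (w * q).
  rewrite -ler_sqr ?nnegrE ?sqrtr_ge0 ?mulr_ge0 ?(ltW w0)//.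
  rewrite sqr_sqrtr ?divr_ge0 ?mulr_ge0 ?(ltW r0)//.
  rewrite !exprMn w2 q2.
  have m1 : 1 <= m%:R :> R by rewrite ler1n.
  rewrite mulrAC [leLHS]mulrC mulrA ler_wpM2r ?divr_ge0 ?(ltW r0)//.
  by rewrite -[m.+1]addn1 natrD; lra.
rewrite tE ler_pdivrMr ?mulr_gt0//.
rewrite (_ : _ * (16 * K) = 2 * (w * q)) //; by field; rewrite gt_eqF.
Qed.

End lower_bounds.

(** * Combination of the radial and orthogonal bounds *)

Theorem theorem3p1 (R : realType) :
  exists C c : R, 0 < C /\ 0 < c /\
    forall (d n : nat) (R0 : R), (0 < d)%N -> 1 <= R0 ->
      C * (R0 + d%:R / R0) <= n%:R ->
      forall est : {mfun n.-tuple (d.-tuple R * bool)%type >-> d.-tuple R},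
        ((c * (Num.sqrt (R0 * d%:R / n%:R) + Num.sqrt (R0 ^+ 3 / n%:R)))%:E
           <= ereal_sup [set risk est theta | theta in shell R0])%E.
Proof.
pose K := gauss_const R; have K16 : 16 <= K := gauss_const_ge16 R.
have K0 : 0 < K by lra.
(* The 4 is the requirement of [orthogonal_lower_bound]. Each of the two terms divided by [256 * K]
   is a lower bound, hence so is their average. *)
exists 4, (1 / (512 * K)); split; first by [].
have K256 : 0 < 256 * K by lra.
split; first by apply: divr_gt0; lra.
move=> [//|m] n r _ r1 nr est.
have r0 : 0 < r by lra.
have dr0 : 0 <= m.+1%:R / r by rewrite divr_ge0// ltW.
have n0 : 0 < n%:R :> R by lra.
have rn : r <= n%:R by lra.
set S := ereal_sup _.
have risk_S theta : shell r theta -> (risk est theta <= S)%E.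
  by move=> sh; apply: ereal_sup_ubound; exists theta.
set a := Num.sqrt (r * _ / _); set b := Num.sqrt (r ^+ 3 / _).
have a0 : 0 <= a by exact: sqrtr_ge0.
have b0 : 0 <= b by exact: sqrtr_ge0.
have bS s : (forall theta, shell r theta -> (risk est theta <= s%:E)%E) ->
    b / 256 <= s.
  exact: radial_lower_bound.
have aS s : (forall theta, shell r theta -> (risk est theta <= s%:E)%E) ->
    a / (256 * K) <= s.
  move=> risk_s; have [m0|m0] := posnP m; last first.
    apply: le_trans (orthogonal_lower_bound m0 r1 nr risk_s).
    by apply: ler_wpM2l => //; rewrite lef_pV2 ?posrE -/K; lra.
  (* In dimension 1 there is no orthogonal direction, but [r <= r ^ 3]. *)
  have ab : a <= b.
    rewrite /a /b m0 mulr1 ler_wsqrtr// ler_wpM2r ?invr_ge0 ?(ltW n0)//.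
    by rewrite ler_eXnr.
  apply: le_trans (bS s risk_s).
  apply: ler_pM => //; first by rewrite invr_ge0 ltW.
  by rewrite lef_pV2 ?posrE; lra.
case: S risk_S => [s| |] risk_S; last 2 first.
- exact: leey.
(* A supremum equal to [-oo] would make [s = -1] an admissible bound, contradicting [b >= 0]. *)
- have : b / 256 <= -1.
    by apply: bS => theta sh; apply: le_trans (risk_S theta sh) _; exact: leNye.
  by rewrite leNgt (lt_le_trans (ltrN10 R) (divr_ge0 b0 (ler0n R 256))).
have as_ := aS s risk_S; have bs := bS s risk_S.
have b256 : b / (256 * K) <= b / 256.
  by apply: ler_wpM2l => //; rewrite lef_pV2 ?posrE; lra.
rewrite lee_fin (_ : _ * (a + b) = (a / (256 * K) + b / (256 * K)) / 2); first by lra.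
by field; rewrite gt_eqF.
Qed.
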